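(* Let $m\ge 2$ and $G = Q_{4m} = \langle x, y : x^{2m} = 1,\ x^m = y^2,\ y^{-1}xy = x^{-1}\rangle$. (1) If $m=2,3$ then $E(\mathcal{CCC}(G)) = LE^+(\mathcal{CCC}(G)) = LE(\mathcal{CCC}(G))$. (2) If $m=5$ then $LE^+(\mathcal{CCC}(G)) < E(\mathcal{CCC}(G)) < LE(\mathcal{CCC}(G))$. (3) If $m=7$ then $LE^+(\mathcal{CCC}(G)) = E(\mathcal{CCC}(G)) < LE(\mathcal{CCC}(G))$. (4) If $m=4,6$ or $m\geq 8$ then $E(\mathcal{CCC}(G)) < LE^+(\mathcal{CCC}(G)) < LE(\mathcal{CCC}(G))$.
   Context: For a finite non-abelian group $G$, the commuting conjugacy class graph $\mathcal{CCC}(G)$ is the simple undirected graph whose vertices are the conjugacy classes of the non-central elements of $G$; two distinct vertices $x^G$ and $y^G$ are adjacent iff there exist $x'\in x^G$ and $y'\in y^G$ with $x'y'=y'x'$. For a finite graph $\mathcal{G}$ with adjacency matrix $A(\mathcal{G})$ and (diagonal) degree matrix $D(\mathcal{G})$, put $L(\mathcal{G})=D(\mathcal{G})-A(\mathcal{G})$ and $Q(\mathcal{G})=D(\mathcal{G})+A(\mathcal{G})$, and let $\mathrm{Spec}(\mathcal{G})$, $\mathrm{L\text{-}Spec}(\mathcal{G})$, $\mathrm{Q\text{-}Spec}(\mathcal{G})$ be the multisets of eigenvalues of $A(\mathcal{G})$, $L(\mathcal{G})$, $Q(\mathcal{G})$. With $d=\frac{2|e(\mathcal{G})|}{|V(\mathcal{G})|}$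 ($|V(\mathcal{G})|$ the number of vertices, $|e(\mathcal{G})|$ the number of edges), the energy, Laplacian energy and signless Laplacian energy are $E(\mathcal{G})=\sum_{\lambda\in \mathrm{Spec}(\mathcal{G})}|\lambda|$, $LE(\mathcal{G})=\sum_{\mu\in \mathrm{L\text{-}Spec}(\mathcal{G})}|\mu-d|$, $LE^+(\mathcal{G})=\sum_{\nu\in \mathrm{Q\text{-}Spec}(\mathcal{G})}|\nu-d|$ (sums with multiplicity). *)

(* Defs.v *)
From HB Require Import structures.
From mathcomp Require Import all_boot all_order all_algebra.
From mathcomp Require Import all_fingroup all_solvable all_field.

Set Implicit Arguments.
Unset Strict Implicit.
Unset Printing Implicit Defensive.

Import Order.TTheory GRing.Theory Num.Theory.

Local Open Scope ring_scope.

Record sgraph := SGraph {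
  vertex :> finType;
  adj : rel vertex;
  adj_sym : symmetric adj;
  adj_irrefl : irreflexive adj
}.

Section Energies.

Variable Gr : sgraph.

Definition edges : {set {set Gr}} :=
  [set E : {set Gr} | [exists u : Gr, exists v : Gr,
                        adj u v && (E == [set u; v])]].

Definition degree (u : Gr) : nat := #|[set v : Gr | adj u v]|.

(* Rows and columns are numbered by the enumeration of the vertex type; the
   entries are taken in algC, which contains all the eigenvalues of the
   integer matrices below. *)
Definition adjmx : 'M[algC]_#|Gr| :=
  \matrix_(i, j) (adj (enum_val i) (enum_val j))%:R.

Definition degmx : 'M[algC]_#|Gr| :=
  diag_mx (\row_i (degree (enum_val i))%:R).

Definition lapmx : 'M[algC]_#|Gr| := degmx - adjmx.

Definition slapmx : 'M[algC]_#|Gr| := degmx + adjmx.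

End Energies.

(* The eigenvalues of A with their multiplicities, in an unspecified order:
   the sequence of the roots of the characteristic polynomial of A. *)
Definition eigenvalues n (A : 'M[algC]_n) : seq algC :=
  sval (closed_field_poly_normal (char_poly A)).

Lemma eigenvaluesP n (A : 'M[algC]_n) :
  char_poly A = \prod_(a <- eigenvalues A) ('X - a%:P).
Proof.
rewrite /eigenvalues; case: closed_field_poly_normal => r /= {1}->.
by rewrite (monicP (char_poly_monic A)) scale1r.
Qed.

Definition avg_degree (Gr : sgraph) : algC := (2 * #|edges Gr|)%N%:R / #|Gr|%:R.

(* The energies are sums of moduli, hence nonnegative reals, on which the
   partial order of algC is the usual order of real numbers. *)
Definition energy (Gr : sgraph) : algC :=
  \sum_(a <- eigenvalues (adjmx Gr)) `|a|.

Definition lap_energy (Gr : sgraph) : algC :=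
  \sum_(a <- eigenvalues (lapmx Gr)) `|a - avg_degree Gr|.

Definition slap_energy (Gr : sgraph) : algC :=
  \sum_(a <- eigenvalues (slapmx Gr)) `|a - avg_degree Gr|.

Section CommutingConjugacyClassGraph.

Local Open Scope group_scope.

Variables (gT : finGroupType) (G : {group gT}).

Definition noncentral_classes : {set {set gT}} :=
  [set x ^: G | x in G :\: 'Z(G)].

Definition ccc_vertex : finType :=
  {C : {set gT} | C \in noncentral_classes}.

Definition ccc_adj : rel ccc_vertex := fun C D =>
  (C != D) && [exists x in val C, exists y in val D, x * y == y * x].

Lemma ccc_adj_sym : symmetric ccc_adj.
Proof.
suff H C D : ccc_adj C D -> ccc_adj D C by move=> C D; apply/idP/idP; apply: H.
case/andP=> neqCD /existsP[x /andP[Cx /existsP[y /andP[Dy /eqP xy]]]].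
rewrite /ccc_adj eq_sym neqCD; apply/existsP; exists y; rewrite Dy /=.
by apply/existsP; exists x; rewrite Cx xy eqxx.
Qed.

Lemma ccc_adj_irrefl : irreflexive ccc_adj.
Proof. by move=> C; rewrite /ccc_adj eqxx. Qed.

Definition CCC : sgraph := SGraph ccc_adj_sym ccc_adj_irrefl.

End CommutingConjugacyClassGraph.

(* In presentations of mathcomp.fingroup, x ^ y is y^-1 * x * y.  The types
   'Q_(4 * m) of mathcomp.solvable.extremal are the intended groups only when
   m is a power of 2, hence the explicit presentation. *)
Definition is_dicyclic (m : nat) (gT : finGroupType) (G : {group gT}) : Prop :=
  (G \isog Grp (x : y : x ^+ (2 * m) = 1, x ^+ m = y ^+ 2, x ^ y = x^-1))%g.

(* Main.v *)
(** Write m = p + 2. Every element of G is x^k or x^k y, where x has order 2m;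
    this order comes from an action of G on 4m points, since relations alone
    only bound it from above. The non-central classes are {x^k, x^-k} for
    0 < k < m, pairwise adjacent, and the classes of y and xy, adjacent to none
    of these, and to each other exactly when m is odd: x^i y and x^j y commute
    iff i = j mod m, and the two classes are given by the parity of i.
    So CCC(G) is the disjoint union of a complete graph on p + 1 vertices with
    one edge (m odd) or two isolated vertices (m even). Its matrices are block
    diagonal with blocks of the form a I + b J, whose spectrum is explicit, and
    the theorem reduces to inequalities between rational functions of p. *)

Require Import Defs.
From mathcomp Require Import all_boot all_order all_algebra.
From mathcomp Require Import all_fingroup all_solvable all_field.
From mathcomp Require Import zify ring lra.

Set Implicit Arguments.
Unset Strict Implicit.
Unset Printing Implicit Defensive.

Import Order.TTheory GRing.Theory Num.Theory.

Local Open Scope ring_scope.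

(** * Characteristic polynomials and eigenvalues *)

(** A split polynomial determines its roots up to order, so any explicit factorization can replace
    the unspecified sequence [eigenvalues A]. *)
Lemma sum_eigenvalues n (A : 'M[algC]_n) (s : seq algC) (f : algC -> algC) :
  char_poly A = \prod_(a <- s) ('X - a%:P) ->
  \sum_(a <- eigenvalues A) f a = \sum_(a <- s) f a.
Proof. by rewrite eigenvaluesP => /prod_XsubC_eq; apply: perm_big. Qed.

Lemma char_poly_similar (F : fieldType) n (P A B : 'M[F]_n) :
  P \in unitmx -> P *m A = B *m P -> char_poly A = char_poly B.
Proof.
move=> uP PA_BP; rewrite /char_poly.
have detP : \det (map_mx polyC P) != 0.
  by rewrite det_map_mx polyC_eq0 -unitfE -unitmxE.
apply: (mulfI detP); rewrite [RHS]mulrC -!det_mulmx; congr (\det _).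
by rewrite /char_poly_mx mulmxBr mulmxBl scalar_mxC -!map_mxM PA_BP.
Qed.

(** [enum_rank \o g] permutes the indices, so the two matrices are conjugate by a permutation
    matrix. This removes the enumeration order of the vertices from later computations. *)
Lemma char_poly_reindex (F : fieldType) (T : finType) N (g : 'I_N -> T)
    (f : T -> T -> F) :
  bijective g ->
  char_poly (\matrix_(i < #|T|, j < #|T|) f (enum_val i) (enum_val j)) =
  char_poly (\matrix_(i < N, j < N) f (g i) (g j)).
Proof.
move=> bij_g; have N_T : N = #|T| by rewrite -(bij_eq_card bij_g) card_ord.
move: g bij_g; rewrite N_T => g bij_g.
have inj_s : injective (enum_rank \o g).
  exact: inj_comp enum_rank_inj (bij_inj bij_g).
pose s := perm inj_s.
have sE k : enum_val (s k) = g k by rewrite permE /= enum_rankK.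
apply: (@char_poly_similar _ _ (perm_mx s)); first exact: unitmx_perm.
apply/matrixP => i j; rewrite -row_permE -[s in RHS]invgK -col_permE.
by rewrite !mxE -[in LHS](permKV s j) !sE.
Qed.

(** The all-ones row, the first row of [P] below, is a left eigenvector for [a + b *+ n.+1]; modulo
    it the matrix acts as the scalar [a]. *)
Lemma char_poly_scalar_const (F : fieldType) n (a b : F) :
  char_poly (a%:M + const_mx b : 'M[F]_n.+1) =
  \prod_(x <- (a + b *+ n.+1) :: nseq n a) ('X - x%:P).
Proof.
(* Conjugation by P makes the matrix block triangular. *)
pose P : 'M[F]_(1 + n) := block_mx 1 (const_mx 1) 0 1.
pose B : 'M[F]_(1 + n) := block_mx (a + b *+ n.+1)%:M 0 (const_mx b) a%:M.
have uP : P \in unitmx by rewrite unitmxE det_ublock !det1 mulr1 unitr1.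
have defA : a%:M + const_mx b = block_mx (a%:M + const_mx b) (const_mx b)
    (const_mx b) (a%:M + const_mx b) :> 'M[F]_(1 + n).
  rewrite scalar_mx_block -[X in _ + X]submxK add_block_mx !add0r.
  by congr block_mx; apply/matrixP => i j; rewrite !mxE.
have row_const p q c d : const_mx (m := p) (n := n) c *m const_mx d =
                         const_mx (n := q) ((c * d) *+ n).
  apply/matrixP => i j; rewrite !mxE (eq_bigr (fun=> c * d)).
    by rewrite sumr_const card_ord.
  by move=> k _; rewrite !mxE.
rewrite (@char_poly_similar _ _ P _ B uP); last first.
  rewrite [X in P *m X]defA !mulmx_block.
  rewrite !mul0mx !mulmx0 !mul1mx !mulmx1 !add0r !addr0 !mulmxDr !row_const.
  rewrite mul_mx_scalar mul_scalar_mx.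
  congr block_mx; apply/matrixP => i j; rewrite !mxE ?ord1 /= ?mulr1n; try ring.
  by rewrite big_ord1 !mxE; ring.
have trigB : is_trig_mx B.
  by rewrite is_trig_block_mx // eqxx !scalar_mx_is_trig.
rewrite (@char_poly_trig F (1 + n) B trigB) big_split_ord /= big_ord1 big_cons.
rewrite big_nseq block_mxEul !mxE eqxx mulr1n; congr (_ * _).
rewrite (eq_bigr (fun=> 'X - a%:P)) => [|i _].
  by rewrite prodr_const card_ord iter_mulr_1.
by rewrite block_mxEdr !mxE eqxx mulr1n.
Qed.

Lemma char_poly_diag_block (F : fieldType) m n (A : 'M[F]_m) (B : 'M[F]_n) :
  char_poly (block_mx A 0 0 B) = char_poly A * char_poly B.
Proof. by rewrite /char_poly char_block_diag_mx det_ublock. Qed.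

(** * Degrees and spectra of a complete graph with two extra vertices *)

(** Double counting of arcs: by source they give the degrees; by underlying edge each fibre consists
    of the two orientations, distinct by irreflexivity. *)
Lemma sum_degree (Gr : sgraph) :
  (\sum_(u : Gr) degree u = 2 * #|edges Gr|)%N.
Proof.
pose arcs := [set p : Gr * Gr | adj p.1 p.2].
have -> : (\sum_(u : Gr) degree u = #|arcs|)%N.
  rewrite -sum1_card (eq_bigl (fun p => true && adj p.1 p.2));
    last by move=> p; rewrite in_set.
  rewrite -(pair_big_dep xpredT (fun u v => adj u v) (fun=> fun=> 1%N)) /=.
  by apply: eq_bigr => u _; rewrite sum1_card /degree cardsE.
rewrite -sum1_card.
rewrite (partition_big (fun p => [set p.1; p.2]) (mem (edges Gr))) /=.
  rewrite mulnC -sum_nat_const; apply: eq_bigr => E.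
  rewrite inE => /existsP[u /existsP[v /andP[uv /eqP->]]].
  have neq_uv : u != v by apply: contraTneq uv => ->; rewrite adj_irrefl.
  rewrite sum1_card -[RHS](_ : #|[set (u, v); (v, u)]| = 2)%N; last first.
    by rewrite cards2 xpair_eqE (negPf neq_uv).
  apply: eq_card => -[s t]; rewrite [LHS]unfold_in in_set in_set2 /= !xpair_eqE.
  apply/andP/orP => [[st /eqP/setP eq_st]|].
    have neq_st : s != t by apply: contraTneq st => ->; rewrite adj_irrefl.
    have /esym := eq_st s; have /esym := eq_st t; rewrite !inE !eqxx orbT /=.
    case/pred2P=> ts /pred2P[] ss; subst; rewrite ?eqxx in neq_st *; auto.
  case=> /andP[/eqP-> /eqP->]; first by rewrite uv.
  by rewrite adj_sym uv setUC.
move=> [u v]; rewrite inE /= => uv; rewrite inE.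
by apply/existsP; exists u; apply/existsP; exists v; rewrite uv /=.
Qed.

Lemma split_lshift m n (i : 'I_m) : split (lshift n i) = inl i.
Proof. exact: (unsplitK (inl i)). Qed.

Lemma split_rshift m n (i : 'I_n) : split (rshift m i) = inr i.
Proof. exact: (unsplitK (inr i)). Qed.

(* The disjoint union of the complete graph on p + 1 vertices with one edge
   (b true) or two isolated vertices (b false). *)
Definition clique_edge_adj (p : nat) (b : bool) : rel 'I_(p.+1 + 2) :=
  fun i j => match split i, split j with
  | inl i1, inl j1 => i1 != j1
  | inr i2, inr j2 => b && (i2 != j2)
  | _, _ => false
  end.

Section CliqueEdgeSpectra.

Variables (Gr : sgraph) (p : nat) (b : bool) (g : 'I_(p.+1 + 2) -> Gr).
Hypothesis bij_g : bijective g.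
Hypothesis adj_g : forall i j, adj (g i) (g j) = clique_edge_adj b i j.

Let splitlr := (@split_lshift, @split_rshift).

Lemma degree_clique_edge i :
  degree (g i) = if split i is inl _ then p else b : nat.
Proof.
rewrite /degree cardsE -sum1_card (reindex g) /=; last exact: onW_bij.
rewrite (eq_bigl (clique_edge_adj b i)); last by move=> j; rewrite -adj_g.
rewrite big_mkcond big_split_ord /clique_edge_adj /=.
case: (split i) => k.
  rewrite [X in (_ + X)%N]big1 ?addn0; last by move=> j _; rewrite splitlr.
  rewrite (eq_bigr (fun j => if j \in predC1 k then 1 else 0)%N); last first.
    by move=> j _; rewrite splitlr eq_sym.
  by rewrite -big_mkcond sum1_card cardC1 card_ord.
rewrite [X in (X + _)%N]big1 ?add0n; last by move=> j _; rewrite splitlr.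
case: b => /=; last by rewrite big1 // => j _; rewrite splitlr.
rewrite (eq_bigr (fun j => if j \in predC1 k then 1 else 0)%N); last first.
  by move=> j _; rewrite splitlr eq_sym.
by rewrite -big_mkcond sum1_card cardC1 card_ord.
Qed.

(* The adjacency, Laplacian and signless Laplacian matrices are the cases
   (c, e) = (0, 1), (1, -1) and (1, 1). *)
Lemma char_poly_clique_edge (c e : algC) :
  char_poly (c *: degmx Gr + e *: adjmx Gr) =
  \prod_(x <- [:: (c + e) * p%:R, (c + e) * b%:R, (c - e) * b%:R
                & nseq p (c * p%:R - e)]) ('X - x%:P).
Proof.
pose f (u v : Gr) := c * ((degree u)%:R *+ (u == v)) + e * (adj u v)%:R : algC.
have -> : c *: degmx Gr + e *: adjmx Gr =
    \matrix_(i < #|Gr|, j < #|Gr|) f (enum_val i) (enum_val j).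
  by apply/matrixP => i j; rewrite !mxE /f (inj_eq enum_val_inj).
rewrite (char_poly_reindex f bij_g).
(* In the order given by [g], the clique block has diagonal c p and other entries e; the second
   block has diagonal c b and other entries e b. *)
have -> : \matrix_(i, j) f (g i) (g j) =
    block_mx ((c * p%:R - e)%:M + const_mx e) 0
             0 (((c - e) * b%:R)%:M + const_mx (e * b%:R)).
  apply/matrixP => i j; rewrite -[i]splitK -[j]splitK mxE /f adj_g.
  rewrite degree_clique_edge (bij_eq bij_g) /clique_edge_adj !unsplitK.
  case: (split i) (split j) => i' [] j' /=.
  - rewrite block_mxEul !mxE (inj_eq (@lshift_inj _ _)).
    by case: eqP => _ /=; rewrite ?mulr1n ?mulr0n; ring.
  - by rewrite block_mxEur !mxE eq_lrshift /= mulr0n; ring.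
  - by rewrite block_mxEdl !mxE eq_rlshift /= mulr0n; ring.
  rewrite block_mxEdr !mxE (inj_eq (@rshift_inj _ _)).
  by case: eqP => _ /=; case: b => /=; rewrite ?mulr1n ?mulr0n; ring.
rewrite char_poly_diag_block !char_poly_scalar_const !big_cons big_nil.
have -> : c * p%:R - e + e *+ p.+1 = (c + e) * p%:R.
  by rewrite mulrS -mulr_natr; ring.
have -> : (c - e) * b%:R + e * b%:R *+ 2 = (c + e) * b%:R by ring.
ring.
Qed.

Lemma avg_degree_clique_edge :
  avg_degree Gr = (p * p.+1 + 2 * b)%:R / p.+3%:R.
Proof.
rewrite /avg_degree -sum_degree; congr (_%:R / _%:R); last first.
  by rewrite -(bij_eq_card bij_g) card_ord addn2.
rewrite (reindex g) /=; last exact: onW_bij.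
rewrite big_split_ord /= (eq_bigr (fun=> p)); last first.
  by move=> i _; rewrite degree_clique_edge splitlr.
rewrite [X in (_ + X)%N](eq_bigr (fun=> b : nat)); last first.
  by move=> i _; rewrite degree_clique_edge splitlr.
by rewrite !sum_nat_const !card_ord mulnC.
Qed.

End CliqueEdgeSpectra.

(** * Energies in closed form *)

(* The energies are computed in rat, where the order is total and decidable,
   and transported to algC by ratr. *)
Definition mean_degree (p : nat) (b : bool) : rat :=
  (p * p.+1 + 2 * b)%:R / p.+3%:R.

(** Adjacency spectrum: p, b, -b, and -1 with multiplicity p. *)
Definition clique_edge_energy (p : nat) (b : bool) : rat := 2 * (p + b)%:R.

(** Laplacian spectrum: 0 twice, 2b, and p + 1 with multiplicity p. *)
Definition clique_edge_lap_energy (p : nat) (b : bool) : rat :=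
  let d := mean_degree p b in
  2 * `|d| + `|2 * b%:R - d| + p%:R * `|p%:R + 1 - d|.

(** Signless Laplacian spectrum: 2p, 2b, 0, and p - 1 with multiplicity p. *)
Definition clique_edge_slap_energy (p : nat) (b : bool) : rat :=
  let d := mean_degree p b in
  `|2 * p%:R - d| + `|2 * b%:R - d| + `|d| + p%:R * `|p%:R - 1 - d|.

Section CliqueEdgeEnergies.

Variables (Gr : sgraph) (p : nat) (b : bool) (g : 'I_(p.+1 + 2) -> Gr).
Hypothesis bij_g : bijective g.
Hypothesis adj_g : forall i j, adj (g i) (g j) = clique_edge_adj b i j.

Lemma energy_clique_edge : energy Gr = ratr (clique_edge_energy p b).
Proof.
have := char_poly_clique_edge bij_g adj_g 0 1.
rewrite scale0r add0r scale1r /energy => /(sum_eigenvalues (fun a => `|a|)) ->.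
rewrite !big_cons big_nseq iter_addr_0 !add0r !mul0r !mul1r mulN1r normrN sub0r.
rewrite normrN1 !normr_nat rmorphM !rmorph_nat natrD; ring.
Qed.

Lemma lap_energy_clique_edge :
  lap_energy Gr = ratr (clique_edge_lap_energy p b).
Proof.
have := char_poly_clique_edge bij_g adj_g 1 (-1).
rewrite scale1r scaleN1r /lap_energy.
move/(sum_eigenvalues (fun a => `|a - avg_degree Gr|)) => ->.
rewrite (avg_degree_clique_edge bij_g adj_g) /clique_edge_lap_energy.
have -> : (p * p.+1 + 2 * b)%:R / p.+3%:R = ratr (mean_degree p b) :> algC.
  by rewrite fmorph_div !rmorph_nat.
move: (mean_degree p b) => d.
rewrite !rmorphD !rmorphM /= !ratr_norm !(rmorphD, rmorphN, rmorphM) /=.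
rewrite !rmorph_nat !rmorph1.
rewrite !big_cons big_nseq iter_addr_0 subrr !mul0r sub0r normrN.
by rewrite mul1r !opprK; ring.
Qed.

Lemma slap_energy_clique_edge :
  slap_energy Gr = ratr (clique_edge_slap_energy p b).
Proof.
have := char_poly_clique_edge bij_g adj_g 1 1.
rewrite !scale1r /slap_energy.
move/(sum_eigenvalues (fun a => `|a - avg_degree Gr|)) => ->.
rewrite (avg_degree_clique_edge bij_g adj_g) /clique_edge_slap_energy.
have -> : (p * p.+1 + 2 * b)%:R / p.+3%:R = ratr (mean_degree p b) :> algC.
  by rewrite fmorph_div !rmorph_nat.
move: (mean_degree p b) => d.
rewrite !rmorphD !rmorphM /= !ratr_norm !(rmorphD, rmorphN, rmorphM) /=.
rewrite !rmorph_nat !rmorph1.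
rewrite !big_cons big_nseq iter_addr_0 subrr !mul0r sub0r normrN.
by rewrite mul1r; ring.
Qed.

End CliqueEdgeEnergies.

(** * Comparison of the energies *)

Lemma clique_edge_energies_small :
  [/\ forall p, p \in [:: 0; 1]%N ->
        clique_edge_energy p (odd p) = clique_edge_slap_energy p (odd p) /\
        clique_edge_slap_energy p (odd p) = clique_edge_lap_energy p (odd p),
      clique_edge_slap_energy 3 true < clique_edge_energy 3 true /\
      clique_edge_energy 3 true < clique_edge_lap_energy 3 true,
      clique_edge_slap_energy 5 true = clique_edge_energy 5 true /\
      clique_edge_energy 5 true < clique_edge_lap_energy 5 true &
      forall p, p \in [:: 2; 4]%N ->
        clique_edge_energy p (odd p) < clique_edge_slap_energy p (odd p) /\
        clique_edge_slap_energy p (odd p) < clique_edge_lap_energy p (odd p)].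
Proof.
split.
- by move=> p; rewrite !inE => /pred2P[]->; split; apply/eqP; vm_compute.
- by split; vm_compute.
- by split; [apply/eqP|]; vm_compute.
- by move=> p; rewrite !inE => /pred2P[]->; split; vm_compute.
Qed.

Lemma clique_edge_energies_large p b : (6 <= p)%N ->
  clique_edge_energy p b < clique_edge_slap_energy p b /\
  clique_edge_slap_energy p b < clique_edge_lap_energy p b.
Proof.
move=> p6; rewrite /clique_edge_energy /clique_edge_slap_energy.
rewrite /clique_edge_lap_energy natrD.
have p6r : 6 <= p%:R :> rat by rewrite ler_nat.
(* From here on the mean degree enters only through this polynomial identity. *)
have : mean_degree p b * (p%:R + 3) = p%:R * (p%:R + 1) + 2 * b%:R.
  rewrite /mean_degree -[p.+3]addn3 -addn1 !natrD !natrM !natrD; field.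
  by rewrite gt_eqF //; lra.
have b01 : 0 <= (b%:R : rat) <= 1 by case: b.
move: (mean_degree p b) (p%:R) p6r (b%:R : rat) b01 => d q q6 c /andP[c0 c1] dE.
(* These bounds fix the sign inside every absolute value. *)
have d4 : 4 * c < d by nra.
have d2 : 2 <= d by nra.
have d1 : d <= q - 1 by nra.
rewrite (ger0_norm (_ : 0 <= d)); last by lra.
rewrite (ler0_norm (_ : 2 * c - d <= 0)); last by lra.
rewrite (ger0_norm (_ : 0 <= q + 1 - d)); last by lra.
rewrite (ger0_norm (_ : 0 <= q - 1 - d)); last by lra.
rewrite (ger0_norm (_ : 0 <= 2 * q - d)); last by lra.
(* By [dE] the energies are 2q + 2c, 4d - 4c and 6d - 4c, so the claims read 2d > q + 3c and 2d > 0.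
   For c = 1 the first becomes (q - 5)(q + 1) > 0, whence the equality at m = 7. *)
split; nra.
Qed.

(** * A permutation model giving the lower bound on the order *)

Section DicyclicModel.

Local Open Scope group_scope.

Variables (m : nat) (m_gt1 : (1 < m)%N).

Let T : finType := ('Z_(2 * m) * bool)%type.

(* The pair (k, b) stands for x ^+ k * y ^+ b, on which the dicyclic group
   acts by right multiplication. *)
Definition right_mulx (t : T) : T :=
  (if t.2 then t.1 - 1 else t.1 + 1, t.2)%R.

Definition right_muly (t : T) : T :=
  (if t.2 then t.1 + m%:R else t.1, ~~ t.2)%R.

Lemma right_mulx_inj : injective right_mulx.
Proof.
by move=> [i []] [j []] E; have := congr1 snd E => // _; congr pair;
  apply: addIr (congr1 fst E).
Qed.

Lemma right_muly_inj : injective right_muly.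
Proof.
move=> [i []] [j []] E; have := congr1 snd E => // _; congr pair.
  exact: addIr (congr1 fst E).
exact (congr1 fst E).
Qed.

Let X := perm right_mulx_inj.
Let Y := perm right_muly_inj.

Lemma right_mulxXn k t :
  (X ^+ k) t = (if t.2 then t.1 - k%:R else t.1 + k%:R, t.2)%R.
Proof.
case: t => i c /=; elim: k => [|k IHk] /=.
  by rewrite expg0 perm1 subr0 addr0 if_same.
rewrite expgSr permM IHk permE /right_mulx /=.
by case: c {IHk}; rewrite -[k.+1]addn1 natrD ?opprD ?addrA.
Qed.

Lemma natr_2m_eq0 : (2 * m)%:R = 0%R :> 'Z_(2 * m).
Proof. by rewrite pchar_Zp //; lia. Qed.

Lemma model_relations : [/\ X ^+ (2 * m) = 1, X ^+ m = Y ^+ 2 & X ^ Y = X^-1].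
Proof.
have m2 : (- m%:R = m%:R :> 'Z_(2 * m))%R.
  by apply/eqP; rewrite eq_sym -addr_eq0 -natrD addnn -mul2n natr_2m_eq0.
split.
- apply/permP => -[i c].
  by rewrite right_mulxXn perm1 natr_2m_eq0 subr0 addr0 if_same.
- apply/permP => -[i c].
  rewrite right_mulxXn expgS expg1 permM !permE /right_muly /= m2.
  by case: c.
(* The conjugation relation, stated without inverses. *)
- have XYX : X * Y * X = Y.
    apply/permP => -[j d]; rewrite !permM !permE /right_mulx /right_muly /=.
    by case: d => /=; congr pair; ring.
  by apply: (mulIg X); rewrite mulVg /conjg -mulgA XYX mulVg.
Qed.

(** The orbit of (0, false) is all of [T], since [X ^+ k] followed by [Y] or not reaches every pair;
    a group is at least as large as an orbit. *)
Lemma model_card : (4 * m <= #|<[X]> <*> <[Y]>|)%N.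
Proof.
pose M := <[X]> <*> <[Y]>; pose t0 : T := (0%R, false).
have cardT : #|T| = (4 * m)%N.
  by rewrite card_prod card_bool card_ord Zp_cast; lia.
have MX k : X ^+ k \in M by rewrite groupX // mem_gen // inE cycle_id.
have MY : Y \in M by rewrite mem_gen // inE cycle_id orbT.
rewrite -cardT; apply: leq_trans (leq_imset_card (fun s : {perm T} => s t0) M).
apply: subset_leq_card; apply/subsetP => -[k c] _; apply/imsetP.
have Xk0 : (X ^+ (k : nat)) t0 = (k, false).
  by rewrite right_mulxXn /= add0r natr_Zp.
case: c; last by exists (X ^+ (k : nat)).
by exists (X ^+ (k : nat) * Y); rewrite ?groupM // permM Xk0 permE.
Qed.

(** The model satisfies the relations, so it is a homomorphic image of [G] and its order divides
    that of [G]. *)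
Lemma dicyclic_card (gT : finGroupType) (G : {group gT}) :
  is_dicyclic m G -> (4 * m <= #|G|)%N.
Proof.
move=> dicG; apply: leq_trans model_card _.
apply: dvdn_leq => //; apply: card_homg.
rewrite dicG; apply/existsP; exists (X, Y); rewrite /= !xpair_eqE eqxx /=.
by have [-> -> ->] := model_relations; rewrite !eqxx.
Qed.

End DicyclicModel.

(** * Normal form of the elements *)

Section DicyclicGroup.

Local Open Scope group_scope.

(** The relations give [#|G| <= 2 * #[x]] and [#[x] <= 2 * m]; with [4 * m <= #|G|] this forces
    [#[x] = 2 * m]. If [y] were a power of [x], [G] would have at most 2m elements. *)
Lemma dicyclic_generators (m : nat) (gT : finGroupType) (G : {group gT}) :
    (1 < m)%N -> is_dicyclic m G ->
  exists x y, [/\ [/\ x \in G, y \in G & y \notin <[x]>],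
    [/\ #[x] = (2 * m)%N, x ^+ m = y ^+ 2 & x ^ y = x^-1]
    & forall z, z \in G -> exists k, z = x ^+ k \/ z = x ^+ k * y].
Proof.
move=> m_gt1 dicG; have := dicyclic_card m_gt1 dicG.
have /existsP[[x y] /=] := isoGrp_hom dicG.
rewrite !xpair_eqE => /andP[/eqP defG /and3P[/eqP x2m /eqP xm /eqP xy]] leG.
rewrite norm_joinEr ?norms_cycle ?xy ?groupV ?cycle_id // in defG.
have xP z : z \in G -> exists k, z = x ^+ k \/ z = x ^+ k * y.
  rewrite -defG => /mulsgP[_ _ /cycleP[i ->] /cycleP[j ->] ->].
  exists (i + m * j./2)%N; rewrite -[j in y ^+ j]odd_double_half addnC.
  rewrite -mul2n expgD expgM -xm -expgM mulgA -expgD.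
  by case: (odd j); rewrite ?expg1 ?mulg1; auto.
have [Gx Gy] : x \in G /\ y \in G.
  by apply/andP; rewrite -!cycle_subG -mulG_subG defG.
have ox : (#[x] <= 2 * m)%N by rewrite dvdn_leq ?order_dvdn ?x2m //; lia.
have leG2 : (#|G| <= #[x] + #[x])%N.
  have sG : G \subset <[x]> :|: <[x]> :* y.
    apply/subsetP => z /xP[k [] ->]; rewrite inE ?mem_cycle //.
    by rewrite mem_rcoset mulgK mem_cycle orbT.
  apply: leq_trans (subset_leq_card sG) _.
  by apply: leq_trans (leq_card_setU _ _) _; rewrite card_rcoset.
exists x, y; split=> //; last by split=> //; have := leq_trans leG leG2; lia.
split=> //; apply/negP => xy_y.
have /subset_leq_card leGx : G \subset <[x]>.
  by rewrite -defG mul_subG //= cycle_subG.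
have := leq_trans leG leGx; rewrite -[#|<[x]>|]/#[x]; lia.
Qed.

End DicyclicGroup.

(** * Conjugacy classes and commutation *)

Section DicyclicClasses.

Local Open Scope group_scope.

Variables (p : nat) (gT : finGroupType) (G : {group gT}) (x y : gT).
Let m := p.+2.
Hypotheses (Gx : x \in G) (Gy : y \in G) (x'y : y \notin <[x]>).
Hypotheses (ox : #[x] = (2 * m)%N) (xm : x ^+ m = y ^+ 2) (xy : x ^ y = x^-1).
Hypothesis GE : forall z, z \in G -> exists k, z = x ^+ k \/ z = x ^+ k * y.

Lemma expx_eq i j : (x ^+ i == x ^+ j) = (i == j %[mod 2 * m])%N.
Proof. by rewrite eq_expg_mod_order ox. Qed.

(** Inverses become powers with natural exponents, so that [lia] can compare exponents. *)
Lemma expx_inv k : (x ^+ k)^-1 = x ^+ (k * (2 * m).-1).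
Proof.
rewrite mulnC expgM -expgVn; congr (_ ^+ k); apply: (mulgI x).
by rewrite mulgV -expgS prednK // -ox expg_order.
Qed.

Lemma expx_conj k : (x ^+ k) ^ y = (x ^+ k)^-1.
Proof. by rewrite conjXg xy expgVn. Qed.

Lemma mul_y_expx k : y * x ^+ k = (x ^+ k)^-1 * y.
Proof. by rewrite [RHS]conjgC conjVg expx_conj invgK. Qed.

Lemma reflection_notin k : x ^+ k * y \notin <[x]>.
Proof. by rewrite groupMl ?mem_cycle. Qed.

Lemma mem_class_rotation k z :
  (z \in x ^+ k ^: G) = (z == x ^+ k) || (z == (x ^+ k)^-1).
Proof.
have conj_x i j : (x ^+ i) ^ (x ^+ j) = x ^+ i.
  by rewrite conjgE -expgD addnC expgD mulKg.
apply/imsetP/pred2P => [[_ /GE[j [->|->]] ->] | [->|->]].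
- by left.
- by right; rewrite conjgM conj_x expx_conj.
- by exists 1; rewrite ?group1 ?conjg1.
- by exists y; rewrite ?expx_conj.
Qed.

(** Conjugation by a power of [x] shifts the exponent by an even amount, and so does conjugation by
    [y], which turns k into -k = k - 2k. *)
Lemma mem_class_reflection k z :
  reflect (exists j, z = x ^+ (k + 2 * j) * y) (z \in (x ^+ k * y) ^: G).
Proof.
have conj_x i j : (x ^+ i * y) ^ (x ^+ j) = x ^+ (i + 2 * (j * (2 * m).-1)) * y.
  rewrite conjgE -!mulgA mul_y_expx [x ^+ i * _]mulgA expx_inv.
  by rewrite !mulgA -!expgD; congr (x ^+ _ * y); lia.
have conj_y i : (x ^+ i * y) ^ y = x ^+ (i + 2 * (i * m.-1)) * y.
  rewrite conjMg expx_conj conjgE mulKg expx_inv.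
  by congr (x ^+ _ * y); rewrite /m /=; lia.
apply: (iffP imsetP) => [[_ /GE[j [->|->]] ->] | [j ->]].
- by exists (j * (2 * m).-1)%N.
- rewrite conjgM conj_x conj_y -addnA -mulnDr.
  by eexists; reflexivity.
exists (x ^+ j)^-1; first by rewrite groupV groupX.
rewrite conjgE invgK -!mulgA.
rewrite [y * _](_ : _ = x ^+ j * y); last by rewrite [RHS]conjgC expx_conj.
by rewrite !mulgA -!expgD; congr (x ^+ _ * y); lia.
Qed.

(** Moving [y] across inverts [x ^+ k], so commuting means that x^(2k) = 1. *)
Lemma commute_rotation_reflection k l :
  x ^+ k * (x ^+ l * y) = x ^+ l * y * x ^+ k -> (m %| k)%N.
Proof.
rewrite -[RHS]mulgA mul_y_expx !mulgA => /mulIg.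
rewrite -expgD addnC expgD => /mulgI/(congr1 (mulg (x ^+ k))).
rewrite mulgV -expgD addnn -mul2n => /eqP.
by rewrite -order_dvdn ox dvdn_pmul2l.
Qed.

(** The product of the elements with exponents i and j is x^(i-j) y^2, so commuting means 2k = 2l
    mod 2m. *)
Lemma commute_reflections k l :
  (x ^+ k * y * (x ^+ l * y) == x ^+ l * y * (x ^+ k * y)) =
  (k == l %[mod m])%N.
Proof.
have mul_xy i j : x ^+ i * y * (x ^+ j * y) = x ^+ i * (x ^+ j)^-1 * (y * y).
  by rewrite -!mulgA [y * (x ^+ j * y)]mulgA mul_y_expx !mulgA.
rewrite !mul_xy (inj_eq (mulIg _)) -(inj_eq (mulIg (x ^+ (l + k)))).
rewrite {1}expgD !mulgA mulgKV [(l + k)%N]addnC expgD mulgA mulgKV.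
rewrite -!expgD !addnn.
by rewrite expx_eq -!mul2n -!muln_modr eqn_pmul2l.
Qed.

(** The shift [j.+1] skips the central x^0, leaving x, ..., x^(m-1); the last two representatives
    are y and xy. *)
Definition ccc_rep (i : 'I_(p.+1 + 2)) : gT :=
  match split i with
  | inl j => x ^+ j.+1
  | inr j => x ^+ j * y
  end.

Lemma ccc_rep_noncentral i : ccc_rep i \in G :\: 'Z(G).
Proof.
rewrite in_setD /ccc_rep.
case: (split i) => j; (apply/andP; split; last by rewrite ?groupM ?groupX).
  apply/negP => /centerP[_ /(_ y Gy) comm_y].
  have /commute_rotation_reflection :
      x ^+ j.+1 * (x ^+ 0 * y) = x ^+ 0 * y * x ^+ j.+1.
    by rewrite mul1g.
  by move/dvdn_leq; rewrite /m; have := ltn_ord j; lia.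
apply/negP => /centerP[_ /(_ x Gx) comm_x].
have /commute_rotation_reflection : x ^+ 1 * (x ^+ j * y) = x ^+ j * y * x ^+ 1.
  by rewrite expg1.
by move/dvdn_leq; rewrite /m; lia.
Qed.

Lemma ccc_rep_class i : ccc_rep i ^: G \in noncentral_classes G.
Proof. by apply: imset_f; apply: ccc_rep_noncentral. Qed.

Definition ccc_label (i : 'I_(p.+1 + 2)) : CCC G :=
  exist _ (ccc_rep i ^: G) (ccc_rep_class i).

(** Two exponents strictly between 0 and m have a sum below 2m, so x^i is never x^(-j). The classes
    of y and xy differ in the parity of the exponent, well defined as 2m is even. *)
Lemma ccc_label_inj : injective ccc_label.
Proof.
move=> i j /(congr1 val) /= /class_eqP; rewrite /ccc_rep -[in i = j](splitK i).
rewrite -[j in _ = j]splitK.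
case: (split i) (split j) => i' [] j'.
- have lti := ltn_ord i'; have ltj := ltn_ord j'.
  rewrite mem_class_rotation => /orP[].
    rewrite expx_eq !modn_small /m; [|lia|lia].
    by rewrite eqSS => /eqP/val_inj->.
  rewrite eq_sym eq_invg_mul -expgD -order_dvdn ox => /dvdn_leq.
  by rewrite /m; lia.
- case/mem_class_reflection=> k Ex; have := reflection_notin (j' + 2 * k).
  by rewrite -Ex mem_cycle.
- rewrite mem_class_rotation => /pred2P E; have := reflection_notin i'.
  by case: E => ->; rewrite ?groupV mem_cycle.
case/mem_class_reflection=> k /mulIg/eqP.
rewrite expx_eq => /eqP/(congr1 (modn^~ 2)).
rewrite !modn_dvdm ?dvdn_mulr //.
rewrite -modnDmr modnMr addn0 !modn_small // => Eij.
by congr (unsplit (inr _)); apply: val_inj.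
Qed.

Lemma expm_central : x ^+ m \in 'Z(G).
Proof.
apply/centerP; split=> [|_ /GE[j [->|->]]]; rewrite ?groupX //.
  by rewrite /commute -!expgD addnC.
have xmj : x ^+ m * x ^+ j = x ^+ j * x ^+ m by rewrite -!expgD addnC.
by rewrite /commute mulgA xmj xm expgS expg1 !mulgA.
Qed.

Lemma ccc_label_surj C : exists i, ccc_label i = C.
Proof.
case: C => C CP; have /imsetP[z /setDP[Gz Zz] defC] := CP.
suff [i Ci] : exists i, z \in ccc_rep i ^: G.
  by exists i; apply: val_inj; rewrite /= defC; apply/esym/class_eqP.
case: (GE Gz) => k [] Ez; last first.
  have k2 : (odd k < 2)%N by case: odd.
  exists (rshift p.+1 (Ordinal k2)); rewrite /ccc_rep split_rshift /= Ez.
  apply/mem_class_reflection; exists k./2.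
  by rewrite mul2n odd_double_half.
have {}Ez : z = x ^+ (k %% (2 * m)) by rewrite -ox expg_mod_order.
move: (k %% (2 * m))%N (ltn_pmod k (isT : 0 < 2 * m)%N) Ez => {}k ltk Ez.
have k_neq0 : k != 0%N by apply: contraNneq Zz => k0; rewrite Ez k0 group1.
have k_neqm : k != m by apply: contraNneq Zz => km; rewrite Ez km expm_central.
have rep j : (0 < j < m)%N -> (z == x ^+ j) || (z == (x ^+ j)^-1) ->
    exists i, z \in ccc_rep i ^: G.
  move=> ltj zj; have ltj' : (j.-1 < p.+1)%N by move: ltj; rewrite /m; lia.
  exists (lshift 2 (Ordinal ltj')); rewrite /ccc_rep split_lshift /=.
  by rewrite prednK ?mem_class_rotation //; case/andP: ltj.
have [ltkm | lemk] := ltnP k m.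
  by apply: (rep k); rewrite ?Ez ?eqxx //; lia.
(* Beyond m, the inverse x^(2m-k) is the chosen representative. *)
apply: (rep (2 * m - k)%N); first by lia.
rewrite Ez [_ == _^-1]eq_sym eq_invg_mul -expgD subnK; last by lia.
by rewrite -ox expg_order eqxx orbT.
Qed.

Lemma ccc_label_bij : bijective ccc_label.
Proof.
have eq_label C : exists i, ccc_label i == C.
  by have [i <-] := ccc_label_surj C; exists i.
pose f C := xchoose (eq_label C).
have fK C : ccc_label (f C) = C by apply/eqP/(xchooseP (eq_label C)).
by exists f => // i; apply: ccc_label_inj; rewrite fK.
Qed.

Lemma ccc_label_adj i j :
  adj (ccc_label i) (ccc_label j) = clique_edge_adj (odd p) i j.
Proof.
have adjE : adj (ccc_label i) (ccc_label j) = (i != j) &&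
    [exists u in ccc_rep i ^: G, exists v in ccc_rep j ^: G, u * v == v * u].
  by rewrite -(inj_eq ccc_label_inj).
rewrite adjE -(inj_eq (can_inj splitK)) /clique_edge_adj /ccc_rep.
have class_x k l u v : u \in x ^+ k ^: G -> v \in (x ^+ l * y) ^: G ->
    commute u v -> (m %| k)%N.
  move=> uk /mem_class_reflection[t ->] uv.
  apply: (@commute_rotation_reflection k (l + 2 * t)).
  move: uk uv; rewrite mem_class_rotation => /pred2P[] -> // uv.
  by apply/commute_sym; rewrite -[x ^+ k]invgK; apply/commuteV/commute_sym.
have lt_m (k : 'I_p.+1) : ~~ (m %| k.+1)%N.
  by apply/negP => /dvdn_leq; rewrite /m; have := ltn_ord k; lia.
case: (split i) (split j) => i' [] j'.
- rewrite (inj_eq (@inl_inj _ _)); case: eqP => //= _.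
  apply/existsP; exists (x ^+ i'.+1); rewrite class_refl.
  apply/existsP; exists (x ^+ j'.+1); rewrite class_refl /=.
  by rewrite /commute -!expgD addnC.
- apply: contraNF (lt_m i') => /existsP[u /andP[ui /existsP[v /andP[vj /eqP]]]].
  exact: (class_x _ _ _ _ ui vj).
- apply: contraNF (lt_m j') => /existsP[u /andP[ui /existsP[v /andP[vj /eqP]]]].
  by move/esym; apply: (class_x _ _ _ _ vj ui).
rewrite (inj_eq (@inr_inj _ _)) [odd p && _]andbC.
case: eqP => //= neq_ij.
apply/existsP/idP => [[u /andP[ui /existsP[v /andP[vj]]]] | odd_p].
  move: ui vj => /mem_class_reflection[s ->] /mem_class_reflection[t ->].
  rewrite commute_reflections => Est; apply: contra_notT neq_ij => even_p.
  apply: val_inj; rewrite /= -[nat_of_ord i'](@modn_small _ 2) //.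
  rewrite -[nat_of_ord j'](@modn_small _ 2) //.
  (* For even m, congruence mod m preserves parity, which distinguishes the two classes. *)
  have m2 : (2 %| m)%N by rewrite dvdn2 /m /= negbK.
  have /eqP/(congr1 (modn^~ 2)) := Est; rewrite !modn_dvdm //.
  by rewrite -modnDmr modnMr addn0 -[RHS]modnDmr modnMr addn0.
(* As m is odd, both classes contain elements x ^+ i * y with m %| i, and any
   two such elements commute. *)
have xkm k : x ^+ (k * m) * y \in (x ^+ k * y) ^: G.
  (* For odd m, k m = k + 2 k (m - 1)/2. *)
  apply/mem_class_reflection; exists (k * m./2)%N; congr (x ^+ _ * y).
  by rewrite -[in LHS](odd_double_half m) /m /= odd_p -/m; lia.
exists (x ^+ (i' * m) * y); rewrite xkm.
apply/existsP; exists (x ^+ (j' * m) * y); rewrite xkm.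
by rewrite commute_reflections !modnMl.
Qed.

End DicyclicClasses.

(** * Energies of the graph of the dicyclic group *)

Theorem theorem4p2 (m : nat) (hm : (2 <= m)%N) (gT : finGroupType)
    (G : {group gT}) (hG : is_dicyclic m G) :
  [/\ m = 2%N \/ m = 3%N ->
        energy (CCC G) = slap_energy (CCC G) /\
        slap_energy (CCC G) = lap_energy (CCC G),
      m = 5%N ->
        slap_energy (CCC G) < energy (CCC G) /\
        energy (CCC G) < lap_energy (CCC G),
      m = 7%N ->
        slap_energy (CCC G) = energy (CCC G) /\
        energy (CCC G) < lap_energy (CCC G)
    & m = 4%N \/ m = 6%N \/ (8 <= m)%N ->
        energy (CCC G) < slap_energy (CCC G) /\
        slap_energy (CCC G) < lap_energy (CCC G)].
Proof.
have [p mE] : exists p, m = p.+2 by exists m.-2; lia.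
move: hm hG; rewrite mE => hm hG.
have [x [y [[Gx Gy x'y] [ox xm xy] GE]]] := dicyclic_generators hm hG.
have bij := ccc_label_bij Gx Gy x'y ox xm xy GE.
have adjE := ccc_label_adj Gx Gy x'y ox xy GE.
rewrite (energy_clique_edge bij adjE) (slap_energy_clique_edge bij adjE).
rewrite (lap_energy_clique_edge bij adjE) !ltr_rat.
have [E01 E3 E5 E24] := clique_edge_energies_small.
split.
- by move=> p01; have [|-> ->] := E01 p; last by []; case: p01 => -[->].
- by case=> ->.
- by case=> ->; rewrite E5.1; split=> //; exact: E5.2.
case=> [[->]|[[->]|p6]]; [exact: E24|exact: E24|].
exact: clique_edge_energies_large.
Qed.
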